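(* Let $(X,\|\cdot\|)$ be a separable Banach lattice and let $f:X\to X$ be a contraction with constant $k\in(0,1)$, i.e. $\|f(x)-f(y)\|\le k\|x-y\|$ for all $x,y\in X$. Let $[B_r]$ denote the set of all closed balls $[x,r]$ with centre $x\in X$ and radius $r\ge 0$, and define $T:[B_r]\to[B_r]$ by $T([x,r])=[f(x),kr]$. Then $T$ has a unique fixed point. Moreover, for any given $x\in X$, the iterates $f^n(x)$ converge to the fixed point of $T$; that is, the fixed point has the form $[x^*,0]$ with $x^*\in X$, and $\|f^n(x)-x^*\|\to 0$ as $n\to\infty$ for every $x\in X$.
   Context: A Banach lattice is a real Banach space that is also a vector lattice, with $|x|=x\vee(-x)$, such that $|x|\le|y|$ implies $\|x\|\le\|y\|$. The symbol $[x,r]$ denotes the closed ball $\overline{B}_r(x)=\{y\in X:\|x-y\|\le r\}$, regarded as the pair consisting of its centre $x\in X$ and its radius $r\ge 0$ (radius $0$ is allowed); two elements $[x,r]$ and $[y,s]$ are equal iff $x=y$ and $r=s$. A fixed point of $T$ is an element $[x,r]$ with $T([x,r])=[x,r]$. A sequence $[x_n,r_n]$ converges to $[x,r]$ if $\|x_n-x\|\to 0$ and $r_n\to r$. $f^n$ denotes the $n$-fold composition of $f$ with itself. *)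

(* Defs.v *)
From HB Require Import structures.
From mathcomp Require Import all_boot all_order all_algebra.
From mathcomp Require Import all_classical all_reals all_analysis.
Set Implicit Arguments.
Unset Strict Implicit.
Unset Printing Implicit Defensive.
Import Order.TTheory GRing.Theory Num.Theory.
Import numFieldNormedType.Exports.
Local Open Scope classical_set_scope.
Local Open Scope ring_scope.

(* The order is carried by this mixin because Order.Lattice cannot be joined
   with GRing.Lmodule downstream of MathComp: at a generic display the join
   conflicts with Num.POrderedZmodule, at ring_display with Num.RealDomain. *)
HB.mixin Record isVectorLattice (R : realType) V of GRing.Lmodule R V := {
  vle : rel V ;
  vjoin : V -> V -> V ;
  vmeet : V -> V -> V ;
  vle_refl : reflexive vle ;
  vle_anti : antisymmetric vle ;
  vle_trans : transitive vle ;
  vjoin_le : forall x y z : V, vle (vjoin x y) z = vle x z && vle y z ;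
  vle_meet : forall x y z : V, vle z (vmeet x y) = vle z x && vle z y ;
  vleD2r : forall z x y : V, vle x y -> vle (x + z) (y + z) ;
  vleZ2l : forall (a : R) (x y : V), 0 <= a -> vle x y -> vle (a *: x) (a *: y)
}.

#[short(type="vectorLatticeType")]
HB.structure Definition VectorLattice (R : realType) :=
  { V of isVectorLattice R V & GRing.Lmodule R V }.

Definition vabs (R : realType) (V : vectorLatticeType R) (x : V) : V :=
  vjoin x (- x).

HB.mixin Record isBanachLattice (R : realType) V
    of VectorLattice R V & CompleteNormedModule R V := {
  vabs_le_norm : forall x y : V, vle (vabs x) (vabs y) -> `|x| <= `|y|
}.

#[short(type="banachLatticeType")]
HB.structure Definition BanachLattice (R : realType) :=
  { V of isBanachLattice R V & VectorLattice R V & CompleteNormedModule R V }.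

Definition separable_space (T : topologicalType) : Prop :=
  exists2 D : set T, countable D & dense D.

(* Closed balls are kept as centre-radius pairs, not as subsets of X:
   equality compares centres and radii, and the radius may be 0. *)
Record cball (R : realType) (X : normedModType R) := CBall {
  bcenter : X ;
  bradius : {nonneg R}
}.

Definition ball_map (R : realType) (X : normedModType R) (f : X -> X)
    (k : {posnum R}) (b : cball X) : cball X :=
  CBall (f (bcenter b)) (k%:num * (bradius b)%:num)%:nng.

(* Main.v *)
Require Import Defs.
From HB Require Import structures.
From mathcomp Require Import all_boot all_order all_algebra.
From mathcomp Require Import all_classical all_reals all_analysis.
Import Order.TTheory GRing.Theory Num.Theory.
Import numFieldNormedType.Exports.
Local Open Scope classical_set_scope.
Local Open Scope ring_scope.

Set Implicit Arguments.
Unset Strict Implicit.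

(** The map on balls acts separately on centre and radius: by [f] on centres, by multiplication by
    [k] on radii. As [k < 1], only radius 0 is preserved, so fixed balls correspond to fixed points
    of [f] ([ball_map_fixed]). Banach's theorem in the complete space [X] gives exactly one of
    these, and the distance of [iter n f x] to it decays like [k ^+ n] ([iter_contraction_dist]). *)

Lemma totalfun_is_contraction (R : realType) (X : normedModType R)
    (f : X -> X) (k : {posnum R}) :
  k%:num < 1 -> (forall x y : X, `|f x - f y| <= k%:num * `|x - y|) ->
  is_contraction [fun of totalfun f].
Proof.
by move=> k_lt1 f_contr; exists k%:num%:nng; split=> // -[x y] _; exact: f_contr.
Qed.

Lemma iter_contraction_dist (R : numDomainType) (X : normedModType R)
    (f : X -> X) (k : R) (p x : X) (n : nat) :
  0 <= k -> (forall x y : X, `|f x - f y| <= k * `|x - y|) -> f p = p ->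
  `|iter n f x - p| <= `|x - p| * k ^+ n.
Proof.
move=> k_ge0 f_contr fp; elim: n => [|n IHn]; first by rewrite expr0 mulr1.
(* Writing [p] as [f p] makes this a distance between two values of [f], so the contraction yields
   one more factor [k]. *)
rewrite iterS -{1}fp (le_trans (f_contr _ _))// exprS mulrCA.
exact: ler_wpM2l.
Qed.

Lemma iter_contraction_cvg (R : realType) (X : normedModType R)
    (f : X -> X) (k : R) (p x : X) :
  0 <= k < 1 -> (forall x y : X, `|f x - f y| <= k * `|x - y|) -> f p = p ->
  `|iter n f x - p| @[n --> \oo] --> (0 : R).
Proof.
move=> /andP[k_ge0 k_lt1] f_contr fp.
apply: (@squeeze_cvgr _ _ _ _ (fun=> 0) (geometric `|x - p| k)).
- apply: nearW => n; rewrite normr_ge0 /=.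
  exact: iter_contraction_dist.
- exact: cvg_cst.
- by apply: cvg_geometric; rewrite ger0_norm.
Qed.

Lemma ball_map_fixed (R : realType) (X : normedModType R) (f : X -> X)
    (k : {posnum R}) (b : cball X) :
  k%:num < 1 ->
  ball_map f k b = b <-> f (bcenter b) = bcenter b /\ b = CBall (bcenter b) 0%:nng.
Proof.
case: b => x r k_lt1; split=> /=.
  case=> fx kr; split=> //; congr CBall; apply/val_inj => /=.
  (* The radius equation becomes [(k - 1) * r = 0], whose first factor is nonzero because
     [k < 1]. *)
  have /eqP := congr1 val kr; rewrite /= -subr_eq0 -{2}[r%:num]mul1r -mulrBl.
  by rewrite mulf_eq0 subr_eq0 lt_eqF//= => /eqP.
case=> fx [->]; rewrite /ball_map /= fx; congr CBall; apply/val_inj => /=.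
by rewrite mulr0.
Qed.

Theorem theorem3p4 (R : realType)
    (X : banachLatticeType R) (sepX : separable_space X)
    (f : X -> X) (k : {posnum R}) (k_lt1 : k%:num < 1)
    (f_contr : forall x y : X, `|f x - f y| <= k%:num * `|x - y|) :
  (exists! b : cball X, ball_map f k b = b) /\
  (forall b : cball X, ball_map f k b = b ->
     exists xs : X, b = CBall xs 0%:nng /\
       forall x : X, `|iter n f x - xs| @[n --> \oo] --> (0 : R)).
Proof.
(* Banach's theorem is stated for self-maps of a nonempty closed subset; here [f] is packaged as a
   self-map of the full set. *)
have f_ctr := totalfun_is_contraction k_lt1 f_contr.
have k01 : 0 <= k%:num < 1 by rewrite k_lt1 ge0.
split.
  have [|p _ fp] := banach_fixed_point f_ctr closedT; first by exists 0.
  exists (CBall p 0%:nng); split; first exact/ball_map_fixed.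
  (* Any other fixed ball also has radius 0, so only the centres, two fixed points of [f], remain to
     be compared. *)
  move=> b /(ball_map_fixed _ _ k_lt1)[fb ->]; congr CBall.
  exact: (contraction_fixpoint_unique f_ctr).
(* The limit is the centre of the given ball: the geometric estimate holds around any fixed point of
   [f]. *)
move=> b /(ball_map_fixed _ _ k_lt1)[fb bE]; exists (bcenter b); split=> // x.
exact: iter_contraction_cvg k01 f_contr fb.
Qed.
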